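(* Let $A$ be a Banach algebra with a bounded approximate identity and let $\alpha: A\to A$ be a continuous algebra homomorphism. Then every bounded Jordan left $\alpha$-centralizer on $A$ is a left $\alpha$-centralizer on $A$.
   Context: An additive map $T:A\to A$ is called a left $\alpha$-centralizer if $T(xy)=T(x)\alpha(y)$ for all $x,y\in A$. An additive map $T:A\to A$ is called a Jordan left $\alpha$-centralizer if $T(x^2)=T(x)\alpha(x)$ for all $x\in A$. Such a $T$ is bounded if there is a constant $C\ge 0$ with $\|T(x)\|\le C\|x\|$ for all $x\in A$. A bounded approximate identity is a norm-bounded net $(e_i)$ in $A$ with $\|e_i x-x\|\to 0$ and $\|xe_i-x\|\to 0$ for every $x\in A$. *)

(* Defs.v *)
From HB Require Import structures.
From mathcomp Require Import all_boot all_order all_algebra.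
From mathcomp Require Import all_classical all_reals all_analysis.
From mathcomp Require Import complex.

Set Implicit Arguments.
Unset Strict Implicit.
Unset Printing Implicit Defensive.

Import Order.TTheory GRing.Theory Num.Theory.
Import numFieldNormedType.Exports.

Local Open Scope classical_set_scope.
Local Open Scope ring_scope.

(* A Banach algebra may be real or complex.  The norm of a normed module over
   R[i] takes its values in R[i], where 0 <= z forces z to be real. *)
Variant scalar_kind := RealScalars | ComplexScalars.

Definition scalars (R : realType) (k : scalar_kind) : numFieldType :=
  match k with
  | RealScalars => R
  | ComplexScalars => R[i]
  end.

(* Library rings have a unit, whereas a Banach algebra need not have one, so
   the product is added here to a complete normed module. *)
HB.mixin Record CompleteNormedModule_isBanachAlgebra (K : numFieldType) A
    of CompleteNormedModule K A := {
  bmul : A -> A -> A;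
  bmulA : associative bmul;
  bmulDl : left_distributive bmul +%R;
  bmulDr : right_distributive bmul +%R;
  bscaleAl : forall (k : K) (x y : A), k *: bmul x y = bmul (k *: x) y;
  bscaleAr : forall (k : K) (x y : A), k *: bmul x y = bmul x (k *: y);
  ler_normbM : forall x y : A, `|bmul x y| <= `|x| * `|y|
}.

#[short(type="banachAlgType")]
HB.structure Definition BanachAlgebra (K : numFieldType) :=
  {A of CompleteNormedModule_isBanachAlgebra K A & CompleteNormedModule K A}.

Declare Scope banach_scope.
Delimit Scope banach_scope with banach.
Notation "x ** y" := (bmul x y) (at level 40, left associativity) : banach_scope.
Local Open Scope banach_scope.

Record directed_preorder (I : Type) (le : I -> I -> Prop) : Prop := {
  directed_refl : forall i, le i i;
  directed_trans : forall i j k, le i j -> le j k -> le i k;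
  directed_inhabited : exists i : I, True;
  directed_upper : forall i j, exists k, le i k /\ le j k
}.

Definition net_tails (I : Type) (le : I -> I -> Prop) : set_system I :=
  [set S | exists i0, forall i, le i0 i -> S i].

Section BanachAlgebraDefs.
Variables (K : numFieldType) (A : banachAlgType K).

Record bounded_approximate_identity (I : Type) (le : I -> I -> Prop)
    (e : I -> A) : Prop := {
  bai_directed : directed_preorder le;
  bai_bounded : exists M : K, forall i, `|e i| <= M;
  bai_left : forall x : A,
    `|e i ** x - x| @[i --> net_tails le] --> (0 : K^o);
  bai_right : forall x : A,
    `|x ** e i - x| @[i --> net_tails le] --> (0 : K^o)
}.

Definition has_bounded_approximate_identity : Prop :=
  exists (I : Type) (le : I -> I -> Prop) (e : I -> A),
    bounded_approximate_identity le e.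

Definition algebra_homomorphism (alpha : A -> A) : Prop :=
  linear alpha /\ {morph alpha : x y / x ** y}.

Definition additive_map (T : A -> A) : Prop := {morph T : x y / x + y}.

Definition left_centralizer (alpha T : A -> A) : Prop :=
  additive_map T /\ forall x y : A, T (x ** y) = T x ** alpha y.

Definition jordan_left_centralizer (alpha T : A -> A) : Prop :=
  additive_map T /\ forall x : A, T (x ** x) = T x ** alpha x.

Definition bounded_map (T : A -> A) : Prop :=
  exists2 C : K, 0 <= C & forall x : A, `|T x| <= C * `|x|.

End BanachAlgebraDefs.

Arguments has_bounded_approximate_identity {K} A.

(* Main.v *)
(** The identity [T (x ** x) = T x ** alpha x] polarises to
    [T (x ** y) + T (y ** x) = T x ** alpha y + T y ** alpha x].  Hence every
    element [T (x ** y + y ** x)] is a sum of products [a ** alpha b], so it is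
    the limit of its products on the right by [alpha (e i)].  These elements
    approximate [2 T x] (take [y := e j]) and [alpha (e i)] is bounded, so
    [T x ** alpha (e i)] tends to [T x].  Polarisation at [y := e i] then shows
    that [T (e i) ** alpha x] tends to [T x], and passing to the limit in
    [T (e i) ** alpha (x ** y) = (T (e i) ** alpha x) ** alpha y] concludes. *)
Require Import Defs.
From HB Require Import structures.
From mathcomp Require Import all_boot all_order all_algebra.
From mathcomp Require Import all_classical all_reals all_analysis.

Set Implicit Arguments.
Unset Strict Implicit.
Unset Printing Implicit Defensive.

Import Order.TTheory GRing.Theory Num.Theory.
Import numFieldNormedType.Exports.

Local Open Scope classical_set_scope.
Local Open Scope ring_scope.
Local Open Scope banach_scope.

Lemma net_tails_proper (I : Type) (le : I -> I -> Prop) :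
  directed_preorder le -> ProperFilter (net_tails le).
Proof.
move=> [lexx le_trans [i0 _] ub]; split; last split.
- by move=> [i /(_ i (lexx i))].
- by exists i0.
- move=> P Q [i Pi] [j Qj]; have [k [ik jk]] := ub i j.
  by exists k => l kl; split; [apply: Pi|apply: Qj]; apply: le_trans kl.
- by move=> P Q PQ [i Pi]; exists i => j /Pi /PQ.
Qed.

Section BanachAlgebraTheory.
Variables (K : numFieldType) (A : banachAlgType K).
Implicit Types (a b x y : A) (alpha T : A -> A).

Lemma bmulBl a b x : (a - b) ** x = a ** x - b ** x.
Proof. by apply/eqP; rewrite eq_sym subr_eq -bmulDl subrK. Qed.

Lemma additive_mapB T : additive_map T -> {morph T : x y / x - y}.
Proof.
by move=> TD x y; apply/eqP; rewrite eq_sym subr_eq -TD subrK.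
Qed.

(** Additivity alone turns the bound into a Lipschitz estimate on differences, so homogeneity never
    enters. *)
Lemma bounded_additive_continuous T :
  additive_map T -> bounded_map T -> continuous T.
Proof.
move=> TD [C C0 TC] x; apply/cvgrPdist_lt => e e0.
(* [C] may vanish, so the division below is by [C + 1]. *)
have C1 : 0 < C + 1 by rewrite ltr_wpDl.
near=> y; rewrite -(additive_mapB TD); apply: le_lt_trans (TC _) _.
apply: (@le_lt_trans _ _ ((C + 1) * `|x - y|)).
  by rewrite ler_wpM2r// lerDl.
rewrite mulrC -ltr_pdivlMr//.
by near: y; apply: (@cvgr_dist_lt _ _ _ (nbhs x) _ idfun x cvg_id); rewrite divr_gt0.
Unshelve. all: by end_near. Qed.

Lemma bmull_continuous a : continuous (bmul a).
Proof.
apply: bounded_additive_continuous => [x y|]; first exact: bmulDr.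
by exists `|a| => // x; apply: ler_normbM.
Qed.

Lemma bmulr_continuous a : continuous (fun x => x ** a).
Proof.
apply: (@bounded_additive_continuous (fun x => x ** a)) => [x y|].
  exact: bmulDl.
by exists `|a| => // x; rewrite mulrC; apply: ler_normbM.
Qed.

Lemma linear_continuous_bounded_map alpha :
  linear alpha -> continuous alpha -> bounded_map alpha.
Proof.
move=> linalpha calpha.
pose f : {linear A -> A} := HB.pack alpha
  (GRing.isLinear.Build K A A *:%R alpha linalpha).
have /linear_boundedP/pinfty_ex_gt0[C C0 fC] : bounded_near f (nbhs 0).
  by apply: continuous_linear_bounded; apply: calpha.
by exists C; [exact: ltW|exact: fC].
Qed.

(** Replacing [a] by a nearby [u] in [S] costs at most [M + 1] times the distance from [a] to [u],
    uniformly in [i]. *)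
Lemma cvg_bmulr_closed (I : Type) (F : set_system I) (FF : Filter F)
    (f : I -> A) (M : K) (S : set A) :
  (forall i, `|f i| <= M) ->
  (forall u, S u -> u ** f i @[i --> F] --> u) ->
  forall a, closure S a -> a ** f i @[i --> F] --> a.
Proof.
move=> fM Sf a Sa; apply/cvgrPdist_lt => e e0.
(* Over an empty index type the estimate is vacuous; otherwise any value of [f] forces [M] to be
   nonnegative. *)
have [[i0]|I0] := pselect (exists i : I, True); last first.
  by apply: filterE => i; exfalso; apply: I0; exists i.
move=> _; have M0 : 0 <= M by apply: le_trans (fM i0).
have M1 : 0 < M + 1 by rewrite ltr_wpDl.
have d0 : 0 < e / 2 / (M + 1) by rewrite !divr_gt0.
have [u [Su au]] := Sa _ (nbhsx_ballx a _ d0).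
move: au; rewrite -ball_normE /= => au.
have /cvgrPdist_lt/(_ (e / 2)) uf := Sf u Su.
apply: filterS (uf _) => [i ufi|]; last by rewrite divr_gt0.
have -> : a - a ** f i = ((a - u) - (a - u) ** f i) + (u - u ** f i).
  by rewrite bmulBl opprD (addrACA a) -opprD subrK.
rewrite [ltRHS]splitr; apply: le_lt_trans (ler_normD _ _) _.
apply: ltrD => //.
apply: le_lt_trans (ler_normB _ _) _.
apply: (@le_lt_trans _ _ (`|a - u| * (M + 1))); last by rewrite -ltr_pdivlMr.
rewrite mulrDr mulr1 addrC lerD2r; apply: le_trans (ler_normbM _ _) _.
by rewrite ler_wpM2l.
Qed.

Lemma cvg_normB0 (I : Type) (F : set_system I) (FF : Filter F)
    (f : I -> A) a :
  `|f i - a| @[i --> F] --> (0 : K^o) -> f i @[i --> F] --> a.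
Proof.
move=> /cvgrPdist_lt fa; apply/cvgrPdist_lt => e /fa.
by apply: filterS => i /=; rewrite sub0r normrN normr_id distrC.
Qed.

Lemma jordan_left_centralizer_polar alpha T x y :
  additive_map alpha -> jordan_left_centralizer alpha T ->
  T (x ** y + y ** x) = T x ** alpha y + T y ** alpha x.
Proof.
move=> alphaD [TD TJ]; have := TJ (x + y).
rewrite bmulDl !bmulDr !TD alphaD !bmulDr !bmulDl !TJ.
(* The two square terms, [T x ** alpha x] in front and [T y ** alpha y] at the end, cancel. *)
rewrite -!addrA => /addrI; rewrite !addrA => /addIr ->.
by rewrite addrC.
Qed.

Lemma bounded_jordan_left_centralizer alpha T :
  has_bounded_approximate_identity A ->
  algebra_homomorphism alpha -> continuous alpha ->
  jordan_left_centralizer alpha T -> bounded_map T ->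
  left_centralizer alpha T.
Proof.
move=> [I [le [e [dir [M eM] el er]]]] [linalpha alphaM] calpha TJ Tb.
have TD : additive_map T by case: TJ.
have alphaD : additive_map alpha.
  by move=> x y; have := linalpha 1 x y; rewrite !scale1r.
have FF := net_tails_proper dir.
have Tc := bounded_additive_continuous TD Tb.
have [C C0 alphaC] := linear_continuous_bounded_map linalpha calpha.
have {}el x : e i ** x @[i --> net_tails le] --> x by exact: cvg_normB0.
have {}er x : x ** e i @[i --> net_tails le] --> x by exact: cvg_normB0.
have TeD x : T (x ** e i + e i ** x) @[i --> net_tails le] --> T x + T x.
  by rewrite -TD; apply: continuous_cvg; [exact: Tc|exact: cvgD].
have prodc a b :
    a ** alpha b ** alpha (e i) @[i --> net_tails le] --> a ** alpha b.
  (* Multiplicativity of [alpha] moves [e i] inside: the product is [a ** alpha (b ** e i)]. *)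
  under eq_fun do rewrite -bmulA -alphaM.
  apply: continuous_cvg; first exact: bmull_continuous.
  by apply: continuous_cvg; [exact: calpha|exact: er].
have TDc x : (T x + T x) ** alpha (e i) @[i --> net_tails le] --> T x + T x.
  apply: (@cvg_bmulr_closed _ _ _ _ (C * M)
    (range (fun p : A * A => T (p.1 ** p.2 + p.2 ** p.1)))).
  - by move=> i; apply: le_trans (alphaC _) _; rewrite ler_wpM2l.
  - move=> _ [[a b] _ <-] /=; rewrite (jordan_left_centralizer_polar a b alphaD TJ).
    by under eq_fun do rewrite bmulDl; apply: cvgD; exact: prodc.
  (* By [TeD] every neighbourhood of the limit contains a whole tail of Jordan products; reflexivity
     puts [i0] in its own tail. *)
  - move=> V /TeD [i0 Vi]; exists (T (x ** e i0 + e i0 ** x)); split.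
      by exists (x, e i0).
    by apply: Vi; apply: directed_refl dir _.
have Tr x : T x ** alpha (e i) @[i --> net_tails le] --> T x.
  (* The halving acts on values in [A], where scalars commute with products; [T] itself is only
     additive. *)
  have half a : 2^-1 *: (a + a) = a.
    by rewrite -mulr2n -[a *+ 2]scaler_nat scalerA mulVf ?scale1r// pnatr_eq0.
  rewrite -[X in _ --> X]half.
  under eq_fun do rewrite -[X in X ** _]half -bscaleAl.
  by apply: cvgZr; exact: TDc.
have Tl x : T (e i) ** alpha x @[i --> net_tails le] --> T x.
  rewrite -[X in _ --> X](addrK (T x)).
  (* Polarisation rewrites the term as [T (x ** e i + e i ** x) - T x ** alpha (e i)], which tends
     to [(T x + T x) - T x]. *)
  under eq_fun => i do rewrite -[_ ** _](addKr (T x ** alpha (e i)))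
    -(jordan_left_centralizer_polar x (e i) alphaD TJ) addrC.
  by apply: cvgB; [exact: TeD|exact: Tr].
split=> // x y.
(* The net [T (e i) ** alpha (x ** y)] has limit [T (x ** y)]; regrouped by associativity, it has
   limit [T x ** alpha y]. *)
apply: (cvg_unique (@norm_hausdorff _ _) (Tl (x ** y))).
rewrite /=; under eq_fun do rewrite alphaM bmulA.
by apply: (continuous_cvg _ (@bmulr_continuous (alpha y) (T x))); exact: Tl.
Qed.

End BanachAlgebraTheory.

Theorem theorem2p4 (R : realType) (k : scalar_kind)
    (A : banachAlgType (scalars R k)) (alpha : A -> A)
    (hA : has_bounded_approximate_identity A)
    (halpha : algebra_homomorphism alpha)
    (calpha : continuous alpha) :
  forall T : A -> A,
    jordan_left_centralizer alpha T -> bounded_map T ->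
    left_centralizer alpha T.
Proof. by move=> T; exact: bounded_jordan_left_centralizer. Qed.
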